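(* In the splitting scheme, suppose $0\le\sigma^{n+1/2}\in L^\infty(\Omega)$ and $0\le r^{n+1/2}\le1$. Then after the diffusion step $0\le\sigma^{n+1}\le\|\sigma^{n+1/2}\|_{L^\infty(\Omega)}$ and $0\le r^{n+1}\le1$.
   Context: Setting. $\Omega\subset\mathbb R$ is a bounded open interval. $\chi:[0,\infty)\to\mathbb R$ is an internal energy density: $\chi\in C^0([0,\infty))\cap C^2((0,\infty))$, $\chi''>0$ on $(0,\infty)$, $\lim_{h\downarrow0}\chi'(h)=0$, and the integrals $\kappa(x):=\int_1^x\frac{\chi''(s)}{s}\,ds$, $K(\sigma):=\int_0^\sigma\kappa(x)\,dx$ exist. $\mathcal E(\rho,\eta):=\int_\Omega\chi(\rho+\eta)\,dx$. For $m>0$, $\mathcal P^m(\Omega)$ is the set of nonnegative Borel measures on $\Omega$ of mass $m$; $W_2$ is the quadratic Wasserstein distance, $W_2^2(\mu,\nu)=\inf_\gamma\int|x-y|^2d\gamma$ over couplings. Diffusion step of the splitting scheme with time step $\tau\in(0,1)$: given $r^{n+1/2}$, $\sigma^{n+1/2}$ on $\Omega$, set $\rho^{n+1/2}=r^{n+1/2}\sigma^{n+1/2}$, $\eta^{n+1/2}=(1-r^{n+1/2})\sigma^{n+1/2}$, $m_1=\int_\Omega\rho^{n+1/2}$, $m_2=\int_\Omega\eta^{n+1/2}$; let $(\rho^{n+1},\eta^{n+1})$ be a minimiser over $\mathcal P^{m_1}(\Omega)\times\mathcal P^{m_2}(\Omega)$ of $\frac1{2\tau}\big[W_2^2(\rho,\rho^{n+1/2})+W_2^2(\eta,\eta^{n+1/2})\big]+\mathcal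 E(\rho,\eta)$; set $\sigma^{n+1}=\rho^{n+1}+\eta^{n+1}$ and $r^{n+1}=r^{n+1/2}\circ\mathcal T$, where $\mathcal T$ is the nondecreasing optimal transport map pushing $\sigma^{n+1}$ forward to $\sigma^{n+1/2}$. *)

(* Defs.v *)
From HB Require Import structures.
From mathcomp Require Import all_boot all_order all_algebra.
From mathcomp Require Import all_classical all_reals all_analysis.
Set Implicit Arguments. Unset Strict Implicit. Unset Printing Implicit Defensive.
Import Order.TTheory GRing.Theory Num.Theory.
Import numFieldNormedType.Exports.
Local Open Scope classical_set_scope.
Local Open Scope ring_scope.

Section SplittingDefs.
Context {R : realType}.
Local Notation leb := (@lebesgue_measure R).
Local Notation meas := {measure set (measurableTypeR R) -> \bar R}.
Local Notation meas2 :=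
  {measure set (measurableTypeR R * measurableTypeR R)%type -> \bar R}.

Definition kappa (chi : R -> R) (x : R) : R :=
  if 1 <= x then \int[leb]_(s in `[1, x]) ((derive1n 2 chi) s / s)
  else - \int[leb]_(s in `[x, 1]) ((derive1n 2 chi) s / s).

Definition chi_admissible (chi : R -> R) : Prop :=
  {within `[0, +oo[, continuous chi} /\
  (forall x, 0 < x ->
     derivable chi x 1 /\ derivable (derive1 chi) x 1 /\
     (derive1n 2 chi) @ x --> (derive1n 2 chi) x) /\
  (forall x, 0 < x -> 0 < (derive1n 2 chi) x) /\
  ((derive1 chi) h @[h --> 0^'+] --> 0) /\
  (* kappa(x) exists for every x > 0 *)
  (forall x, 0 < x ->
     leb.-integrable `[Num.min 1 x, Num.max 1 x]
        (fun s => ((derive1n 2 chi) s / s)%:E)) /\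
  (* K(sigma) = int_0^sigma kappa exists for every sigma > 0 *)
  (forall sg, 0 < sg -> leb.-integrable `]0, sg] (fun x => (kappa chi x)%:E)).

(** P^m(Omega): nonnegative Borel measures on Omega of mass m, represented
    as Borel measures on R giving no mass to the complement of Omega. *)
Definition in_Pm (Om : set R) (m : R) (mu : meas) : Prop :=
  mu (~` Om) = 0%E /\ mu Om = m%:E.

Definition coupling (mu nu : meas) (g : meas2) : Prop :=
  (forall A, measurable A -> g (fst @^-1` A) = mu A) /\
  (forall B, measurable B -> g (snd @^-1` B) = nu B).

Definition W2sq (mu nu : meas) : \bar R :=
  ereal_inf [set (\int[g]_z ((z.1 - z.2) ^+ 2)%:E)%E | g in coupling mu nu].

Definition has_density (Om : set R) (mu : meas) (f : R -> R) : Prop :=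
  measurable_fun Om f /\ (forall x, Om x -> 0 <= f x) /\
  (forall A, measurable A -> mu A = (\int[leb]_(x in A `&` Om) (f x)%:E)%E).

(** E(rho, eta) = int_Omega chi(rho + eta) dx  (+oo if rho or eta is not
    absolutely continuous). *)
Definition energy (chi : R -> R) (Om : set R) (rho eta : meas) : \bar R :=
  ereal_inf [set (\int[leb]_(x in Om) (chi (f.1 x + f.2 x))%:E)%E
            | f in [set f : (R -> R) * (R -> R) |
                    has_density Om rho f.1 /\ has_density Om eta f.2]].

Definition diffusion_obj (tau : R) (chi : R -> R) (Om : set R)
    (rh eh rho eta : meas) : \bar R :=
  (((2 * tau)^-1)%:E * (W2sq rho rh + W2sq eta eh) + energy chi Om rho eta)%E.

Definition diffusion_minimizer (tau : R) (chi : R -> R) (Om : set R)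
    (m1 m2 : R) (rh eh rho eta : meas) : Prop :=
  in_Pm Om m1 rho /\ in_Pm Om m2 eta /\
  forall rho' eta', in_Pm Om m1 rho' -> in_Pm Om m2 eta' ->
    (diffusion_obj tau chi Om rh eh rho eta <=
     diffusion_obj tau chi Om rh eh rho' eta')%E.

Definition Linf_norm (Om : set R) (f : R -> R) : \bar R :=
  ereal_inf [set M : \bar R | {ae leb, forall x, Om x -> ((`|f x|)%:E <= M)%E}].

End SplittingDefs.

(* Main.v *)
Require Import Defs.
From HB Require Import structures.
From mathcomp Require Import all_boot all_order all_algebra.
From mathcomp Require Import all_classical all_reals all_analysis.
From mathcomp Require Import measurable_realfun lra ring.
Set Implicit Arguments. Unset Strict Implicit. Unset Printing Implicit Defensive.
Import Order.TTheory GRing.Theory Num.Theory.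
Import numFieldNormedType.Exports.
Local Open Scope classical_set_scope.
Local Open Scope ring_scope.

(** The minimiser is compared with the competitor obtained by moving mass along
    transport plans.  Let S be the density of rho + eta, let L exceed the
    essential supremum of sigma, and suppose that A = {S > L} has positive
    measure.  Since the target density is at most L on A, every pair of plans
    from (rho, eta) to (rh, eh) sends a definite amount of mass from A to its
    complement.  For a fraction e of this mass, replace the departure point x
    by the arrival point y.  The transport cost does not increase, since this
    mass now stays put; the energy drops, because mass leaves a region where
    S > L for a region where S <= L and chi' is increasing.  The drop is bounded
    below independently of the plans, so nearly optimal plans suffice and no
    optimal plan has to be constructed. *)

(** * The internal energy density *)

Section EnergyDensity.
Context {R : realType}.
Variable chi : R -> R.
Hypothesis chiP : chi_admissible chi.

Lemma chi_mean_value (u v : R) : 0 <= u -> u < v ->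
  exists2 c, u < c < v & chi v - chi u = derive1 chi c * (v - u).
Proof.
case: chiP => cont [der _] u0 uv.
have [c|c|c cuv ->] := @MVT R chi (derive1 chi) u v uv.
- rewrite in_itv/= => /andP[uc _].
  have [/derivableP + _] := der c (le_lt_trans u0 uc).
  by rewrite -derive1E.
- apply: continuous_subspaceW cont c => x /=; rewrite !in_itv/= andbT.
  by move=> /andP[/(le_trans u0)].
- by exists c => //; move: cuv; rewrite in_itv.
Qed.

Lemma dchi_continuous (x : R) : 0 < x -> {for x, continuous (derive1 chi)}.
Proof.
case: chiP => _ [der _] /der[_ [/derivable1_diffP dx _]].
exact: differentiable_continuous.
Qed.

Lemma dchi_lt (x y : R) : 0 < x -> x < y -> derive1 chi x < derive1 chi y.
Proof.
move=> x0 xy; case: chiP => _ [der [d2 _]].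
have [c||c] := @MVT R (derive1 chi) (derive1n 2 chi) x y xy.
- rewrite in_itv/= => /andP[xc _].
  have [_ [/derivableP + _]] := der c (lt_trans x0 xc).
  by rewrite -derive1E.
- apply: derivable_within_continuous => c; rewrite in_itv/= => /andP[xc _].
  by have [_ []] := der c (lt_le_trans x0 xc).
- rewrite in_itv/= => /andP[xc _] e; rewrite -subr_gt0 e mulr_gt0 ?subr_gt0//.
  exact/d2/(lt_trans x0).
Qed.

Lemma dchi_le (x y : R) : 0 < x -> x <= y -> derive1 chi x <= derive1 chi y.
Proof.
move=> x0; rewrite le_eqVlt => /predU1P[->//|xy]; exact/ltW/dchi_lt.
Qed.

Lemma dchi_gt0 (x : R) : 0 < x -> 0 < derive1 chi x.
Proof.
move=> x0; rewrite ltNge; apply/negP => dx.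
have x2 : 0 < x / 2 by rewrite divr_gt0.
have dx2 : derive1 chi (x / 2) < 0.
  by apply: lt_le_trans dx; apply: dchi_lt => //; lra.
case: chiP => _ [_ [_ [/cvgrPdist_lt lim0 _]]].
have /lim0 : 0 < - derive1 chi (x / 2) by lra.
move=> /(filterI (nbhs_right_lt x2)) /(filterI (nbhs_right_gt 0)) /filter_ex[h].
move=> [h0 [hx]]; rewrite sub0r normrN => dh.
have := dchi_lt h0 hx; have := ler_norm (- derive1 chi h); rewrite normrN; lra.
Qed.

Lemma chi_le (u v : R) : 0 <= u -> u <= v -> chi u <= chi v.
Proof.
move=> u0; rewrite le_eqVlt => /predU1P[->//|uv].
have [c /andP[uc cv] e] := chi_mean_value u0 uv.
rewrite -subr_ge0 e mulr_ge0 ?subr_ge0//; last exact: ltW.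
exact/ltW/dchi_gt0/(le_lt_trans u0).
Qed.

Lemma chi_slope_ge (u v w : R) : 0 < w -> w <= u -> u <= v ->
  derive1 chi w * (v - u) <= chi v - chi u.
Proof.
move=> w0 wu; rewrite le_eqVlt => /predU1P[->|uv]; first by rewrite !subrr mulr0.
have [|c /andP[uc cv] ->] := chi_mean_value _ uv; first lra.
rewrite ler_wpM2r ?subr_ge0 ?(ltW uv)//; apply: dchi_le => //; lra.
Qed.

Lemma chi_slope_le (u v w : R) : 0 <= u -> u <= v -> v <= w ->
  chi v - chi u <= derive1 chi w * (v - u).
Proof.
move=> u0; rewrite le_eqVlt => /predU1P[->|uv vw]; first by rewrite !subrr mulr0.
have [c /andP[uc cv] ->] := chi_mean_value u0 uv.
rewrite ler_wpM2r ?subr_ge0 ?(ltW uv)//; apply: dchi_le; lra.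
Qed.

Lemma dchi_gap (L L' c m : R) : 0 < L -> L < L' -> 0 < c ->
  exists2 e, 0 < e < 1 &
    (derive1 chi ((1 + e) * L) - derive1 chi ((1 - e) * L)) * m <
    (derive1 chi ((1 - e) * L') - derive1 chi ((1 - e) * L)) * c.
Proof.
move=> L0 LL' c0; have L'0 : 0 < L' by lra.
pose F (e : R) := (derive1 chi ((1 - e) * L') - derive1 chi ((1 - e) * L)) * c -
   (derive1 chi ((1 + e) * L) - derive1 chi ((1 - e) * L)) * m.
have F0 : 0 < F 0.
  by rewrite /F subr0 addr0 !mul1r subrr mul0r subr0 mulr_gt0// subr_gt0 dchi_lt.
have dchim (x : R) : 0 < x ->
    derive1 chi ((1 - e) * x) @[e --> (0 : R)] --> derive1 chi ((1 - 0) * x).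
  move=> x0; apply: (@continuous_comp _ _ _ (fun e : R => (1 - e) * x) (derive1 chi) 0).
    by apply: cvgM; [apply: cvgB; [exact: cvg_cst|exact: cvg_id]|exact: cvg_cst].
  by apply: dchi_continuous; rewrite subr0 mul1r.
have dchip (x : R) : 0 < x ->
    derive1 chi ((1 + e) * x) @[e --> (0 : R)] --> derive1 chi ((1 + 0) * x).
  move=> x0; apply: (@continuous_comp _ _ _ (fun e : R => (1 + e) * x) (derive1 chi) 0).
    by apply: cvgM; [apply: cvgD; [exact: cvg_cst|exact: cvg_id]|exact: cvg_cst].
  by apply: dchi_continuous; rewrite addr0 mul1r.
have cF : F e @[e --> (0 : R)] --> F 0.
  by apply: cvgB; (apply: cvgM; [apply: cvgB; auto|exact: cvg_cst]).
have Fpos : \forall e \near (0 : R)^'+, 0 < F e.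
  exact: cvg_within (cvgr_gt (F 0) cF _ F0).
have [e [e0 [e1 Fe]]] := filter_ex (filterI (nbhs_right_gt (0 : R))
  (filterI (nbhs_right_lt (@ltr01 R)) Fpos)).
by exists e; [rewrite e0|rewrite -subr_gt0].
Qed.

Lemma chi_exchange (L L' e S G H : R) :
  0 < L -> L < L' -> 0 < e < 1 -> 0 <= G -> G <= S -> 0 <= H -> H <= L ->
  (S <= L -> G = 0) -> (L < S -> H = 0) ->
  chi (S - e * G + e * H)
    + e * ((derive1 chi ((1 - e) * L') - derive1 chi ((1 - e) * L)) *
           (G * (L' < S)%R%:R)
           + derive1 chi ((1 - e) * L) * G)
  <= chi S + e * (derive1 chi ((1 + e) * L) * H).
Proof.
move=> L0 LL' /andP[e0 e1] G0 GS H0 HL SL LS.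
have eG : 0 <= e * G by rewrite mulr_ge0// ltW.
have eH : 0 <= e * H by rewrite mulr_ge0// ltW.
have [SleL|LltS] := leP S L.
  rewrite (SL SleL) mulr0 mul0r !mulr0 addr0 mulr0 addr0 subr0.
  have eHL : e * H <= e * L by rewrite ler_pM2l.
  have := @chi_slope_le S (S + e * H) ((1 + e) * L).
  rewrite mulrDl mul1r addrAC subrr add0r mulrCA => h.
  by rewrite -lerBlDl; apply: h; lra.
rewrite (LS LltS) !mulr0 !addr0.
have eGS : e * G <= e * S by rewrite ler_pM2l.
have e1L : 0 < (1 - e) * L by rewrite mulr_gt0// subr_gt0.
have slope w : 0 < w -> w <= S ->
    derive1 chi ((1 - e) * w) * (e * G) <= chi S - chi (S - e * G).
  move=> w0 wS; have := @chi_slope_ge (S - e * G) S ((1 - e) * w).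
  rewrite (_ : S - (S - e * G) = e * G); last by ring.
  apply.
  - by rewrite mulr_gt0// subr_gt0.
  - apply: (@le_trans _ _ ((1 - e) * S)); last by rewrite mulrBl mul1r; lra.
    by rewrite ler_pM2l// subr_gt0.
  - lra.
have [L'S|SL'] := ltP L' S.
  have := slope L' (lt_trans L0 LL') (ltW L'S); rewrite mulr1; lra.
have := slope L L0 (ltW LltS); rewrite !mulr0 add0r; lra.
Qed.

End EnergyDensity.

(** * Densities of Borel measures *)

Section Densities.
Context {R : realType}.
Local Notation leb := (@lebesgue_measure R).
Local Notation meas := {measure set (measurableTypeR R) -> \bar R}.
Variable Om : set R.
Hypothesis mOm : measurable Om.

Lemma has_density_integrable (mu : meas) f : has_density Om mu f ->
  (mu setT < +oo)%E -> leb.-integrable Om (EFin \o f).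
Proof.
move=> [mf [f0 muE]] fin; apply/integrableP; split; first exact/measurable_EFinP.
rewrite (le_lt_trans _ fin)// muE// setTI le_eqVlt; apply/orP; left; apply/eqP.
by apply: eq_integral => x /[!inE] Ox /=; rewrite ger0_norm ?f0.
Qed.

Lemma has_density_out (mu : meas) f E : has_density Om mu f ->
  measurable E -> mu (E `\` Om) = 0%E.
Proof.
move=> [_ [_ muE]] mE; rewrite muE; last exact: measurableD.
by rewrite setDE -setIA setICl setI0 integral_set0.
Qed.

Lemma has_density_restr (mu : meas) f A (mA : measurable A) :
  has_density Om mu f -> has_density Om (mrestr mu mA) (f \_ A).
Proof.
move=> [mf [f0 muE]]; split; [|split] => [|x Ox|E mE].
- by apply/measurable_restrict => //; apply: measurable_funS mf => //; exact: subIsetl.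
- by rewrite patchE; case: ifP => // _; exact: f0.
- rewrite -[LHS]/(mu (E `&` A)) muE; last exact: measurableI.
  rewrite setIAC integral_mkcondr; apply: eq_integral => x _.
  by rewrite -[RHS]/((EFin \o (f \_ A)) x) -restrict_EFin.
Qed.

Lemma dominated_density (al mu : meas) f : has_density Om mu f ->
  (mu setT < +oo)%E -> (forall E, measurable E -> (al E <= mu E)%E) ->
  exists2 g, has_density Om al g & forall x, Om x -> g x <= f x.
Proof.
move=> muf fin almu.
have [mf [f0 muE]] := muf.
(* On [D] the Radon-Nikodym density exceeds [f], which domination allows only
   up to a null set, so truncating by [f] does not change the integrals. *)
have alfin : (al setT < +oo)%E by apply: le_lt_trans fin; exact: almu.
pose al' : {finite_measure set _ -> \bar R} := mfrestr measurableT alfin.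
have al'E E : al' E = al E by rewrite /al'/= /mfrestr /mrestr setIT.
have al'leb : al' `<< leb.
  move=> N N0 E mE EN; rewrite al'E; apply/eqP; rewrite eq_le measure_ge0 andbT.
  apply: (le_trans (almu _ mE)); rewrite muE// null_set_integral//.
  - exact: measurableI.
  - by apply/measurable_EFinP; apply: measurable_funS mf => //; exact: subIsetr.
  - by apply: N0; [exact: measurableI|apply: subset_trans EN; exact: subIsetl].
have [g0 [g0_ge0 g0fin /integrableP[mg0 _] g0E]] := radon_nikodym_sigma_finite al'leb.
have mg0' : measurable_fun setT (fine \o g0).
  by apply: measurableT_comp => //; exact: fine_measurable.
pose g := (fine \o g0) \min f.
have mg : measurable_fun Om g.
  by apply: measurable_minr => //; apply: measurable_funTS.
have gge0 x : Om x -> 0 <= g x.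
  by move=> Ox; rewrite /g/= le_min f0// fine_ge0.
exists g; last by move=> x _; rewrite /g/= ge_min lexx orbT.
split; [|split] => // E mE.
pose D := Om `&` [set x | f x < fine (g0 x)].
have mD : measurable D.
  have := @measurable_fun_ltr _ _ _ Om f (fine \o g0) mf (measurable_funTS mg0').
  by move=> /(_ mOm [set true]); apply.
have measDI A B : measurable A -> measurable B ->
    al A = (al (A `\` B) + al (A `&` B))%E by exact: measureDI.
rewrite (measDI E Om)//.
have -> : al (E `\` Om) = 0%E.
  apply/eqP; rewrite eq_le measure_ge0 andbT -(has_density_out muf mE).
  by apply: almu; exact: measurableD.
rewrite add0e (measDI (E `&` Om) D)//; last exact: measurableI.
set F := E `&` Om; have mF : measurable F by exact: measurableI.
have FOm : F `<=` Om by exact: subIsetr.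
have gF H : measurable H -> H `<=` F -> measurable_fun H (EFin \o g).
  move=> mH HF; apply/measurable_EFinP; apply: measurable_funS mg => //.
  exact: subset_trans FOm.
have int_split : (\int[leb]_(x in F) (g x)%:E = \int[leb]_(x in F `\` D) (g x)%:E
    + \int[leb]_(x in F `&` D) (g x)%:E)%E.
  have FE : F `\` D `|` F `&` D = F by rewrite setUC setUIDK.
  rewrite -{1}FE ge0_integral_setU ?FE//.
  - exact: measurableD.
  - exact: measurableI.
  - exact: gF.
  - by move=> x /FOm Ox; rewrite lee_fin gge0.
  - by apply/disj_setPS => x [[_ nDx] [_ Dx]].
rewrite int_split; congr (_ + _)%E.
  rewrite -al'E g0E; last exact: measurableD.
  apply: eq_integral => x /[!inE] -[Fx nDx]; rewrite /g/= EFin_min fineK//.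
  apply/esym/min_idPl; rewrite -[g0 x]fineK// lee_fin leNgt; apply/negP => fg.
  by apply: nDx; split => //; exact: FOm.
apply/eqP; rewrite eq_le; apply/andP; split.
  apply: (le_trans (almu _ (measurableI _ _ mF mD))).
  rewrite muE; last exact: measurableI.
  rewrite (_ : F `&` D `&` Om = F `&` D); last first.
    by apply/setIidl => x [/FOm].
  rewrite le_eqVlt; apply/orP; left; apply/eqP.
  apply: eq_integral => x /[!inE] -[_ [_ /ltW fg]]; congr EFin.
  by rewrite /g/=; apply/esym/min_idPr.
rewrite -al'E g0E; last exact: measurableI.
apply: ge0_le_integral => //.
- exact: measurableI.
- by move=> x [/FOm Ox _]; rewrite lee_fin gge0.
- by apply: gF; [exact: measurableI|exact: subIsetl].
- exact: measurable_funTS.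
- by move=> x _; rewrite /g/= -[leRHS]fineK// lee_fin ge_min lexx.
Qed.

End Densities.

(** * Exchanging mass along a transport plan *)

Lemma pushforward_measure d d' (T1 : measurableType d) (T2 : measurableType d')
    (R : realType) (m : {measure set T1 -> \bar R}) (f : T1 -> T2) :
  measurable_fun setT f -> exists m' : {measure set T2 -> \bar R},
    m' = pushforward m f :> (set T2 -> \bar R).
Proof.
by move=> mf; unshelve eexists (pushforward m f : {measure set T2 -> \bar R}).
Qed.

Section Exchange.
Context {R : realType}.
Local Notation leb := (@lebesgue_measure R).
Local Notation meas := {measure set (measurableTypeR R) -> \bar R}.
Local Notation meas2 :=
  {measure set (measurableTypeR R * measurableTypeR R)%type -> \bar R}.
Variable Om : set R.
Hypothesis mOm : measurable Om.

Lemma measurable_sqdist :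
  measurable_fun setT (fun z : measurableTypeR R * measurableTypeR R =>
    ((z.1 - z.2) ^+ 2)%:E).
Proof.
apply/measurable_EFinP/measurable_funX/measurable_funB;
  [exact: measurable_fst|exact: measurable_snd].
Qed.

(** [al] and [be] are the departure and arrival marginals of the part of [gam]
    on [A `*` ~` A], and [al2] is the departure marginal of the rest. *)
Lemma transport_exchange_coupling (mu nu : meas) (gam : meas2) (A : set R) (e : R) :
  coupling mu nu gam -> measurable A -> 0 < e < 1 ->
  exists mu' al al2 be : meas, [/\
    forall E, measurable E -> mu E = (al E + al2 E)%E,
    forall E, mu' E = ((1 - e)%:E * al E + (al2 E + e%:E * be E))%E,
    forall E, measurable E -> (al E <= mu (E `&` A))%E /\
                              (be E <= nu (E `&` ~` A))%E,
    al setT = be setT /\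
    forall E, measurable E -> E `<=` A -> (mu E <= al E + nu A)%E &
    mu' setT = nu setT /\
    (W2sq mu' nu <= \int[gam]_z ((z.1 - z.2) ^+ 2)%:E)%E].
Proof.
move=> [gam1 gam2] mA /andP[e0 e1].
pose e' : {nonneg R} := NngNum (ltW e0).
have d0 : 0 <= 1 - e by lra.
pose d' : {nonneg R} := NngNum d0.
pose C : set (measurableTypeR R * measurableTypeR R) := A `*` ~` A.
have mC : measurable C by apply: measurableX => //; exact: measurableC.
have mC' := measurableC mC.
pose rC : meas2 := mrestr gam mC.
pose rD : meas2 := mrestr gam mC'.
have mf (E : set R) : measurable E ->
    measurable (fst @^-1` E : set (measurableTypeR R * measurableTypeR R)).
  by move=> mE; rewrite -[X in measurable X]setTI; exact: measurable_fst.
have ms (E : set R) : measurable E ->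
    measurable (snd @^-1` E : set (measurableTypeR R * measurableTypeR R)).
  by move=> mE; rewrite -[X in measurable X]setTI; exact: measurable_snd.
have [al alE] := pushforward_measure rC measurable_fst.
have [al2 al2E] := pushforward_measure rD measurable_fst.
have [be beE] := pushforward_measure rC measurable_snd.
have mdiag : measurable_fun setT
    (fun z : measurableTypeR R * measurableTypeR R => (z.2, z.2)).
  by apply: measurable_fun_pair; exact: measurable_snd.
have [dg dgE] := pushforward_measure rC mdiag.
pose mu' : meas := measure_add (mscale d' al) (measure_add al2 (mscale e' be)).
pose gam' : meas2 := measure_add (mscale d' rC) (measure_add rD (mscale e' dg)).
have gamDI X : measurable X -> gam X = (rC X + rD X)%E.
  by move=> mX; rewrite addeC; exact: measureDI.
have mu'E E : mu' E = ((1 - e)%:E * al E + (al2 E + e%:E * be E))%E.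
  apply: (etrans (measure_addE (mscale d' al) _ E)); congr (_ + _)%E.
  exact: measure_addE.
have gam'E X : gam' X = ((1 - e)%:E * rC X + (rD X + e%:E * dg X))%E.
  apply: (etrans (measure_addE (mscale d' rC) _ X)); congr (_ + _)%E.
  exact: measure_addE.
have cpl : coupling mu' nu gam'.
  split => B mB; rewrite gam'E dgE.
    by rewrite mu'E alE al2E beE.
  rewrite -gam2// (gamDI _ (ms _ mB)) /pushforward.
  rewrite addeCA -ge0_muleDl ?lee_fin ?(ltW e0)//.
  by rewrite -EFinD subrK mul1e addeC.
exists mu', al, al2, be; split => //.
- by move=> E mE; rewrite -gam1// (gamDI _ (mf _ mE)) alE al2E.
- move=> E mE; split.
    rewrite -gam1; last exact: measurableI.
    rewrite alE; apply: le_measure; rewrite ?inE.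
    + by apply: measurableI => //; exact: mf.
    + by apply: mf; exact: measurableI.
    + by move=> z [Ez [Az _]].
  rewrite -gam2; last by apply: measurableI => //; exact: measurableC.
  rewrite beE; apply: le_measure; rewrite ?inE.
  + by apply: measurableI => //; exact: ms.
  + by apply: ms; apply: measurableI => //; exact: measurableC.
  + by move=> z [Ez [_ Az]].
- split; first by rewrite alE beE /pushforward !preimage_setT.
  move=> E mE EA; rewrite -gam1// -gam2// alE.
  apply: (@le_trans _ _ (gam ((fst @^-1` E `&` C) `|` snd @^-1` A))).
    apply: le_measure; rewrite ?inE.
    + exact: mf.
    + by apply: measurableU; [apply: measurableI => //; exact: mf|exact: ms].
    + move=> z Ez; have [Az2|nAz2] := pselect (A z.2); [by right|left].
      by split => //; split => //; exact: EA.
  apply: measureU2; last exact: ms.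
  by apply: measurableI => //; exact: mf.
- split.
    by rewrite -(cpl.2 _ measurableT) -(cpl.1 _ measurableT) !preimage_setT.
  apply: (@le_trans _ _ (\int[gam']_z ((z.1 - z.2) ^+ 2)%:E)%E).
    by apply: ereal_inf_lbound; exists gam'.
  have c0 (z : measurableTypeR R * measurableTypeR R) : setT z ->
      (0 <= ((z.1 - z.2) ^+ 2)%:E)%E.
    by move=> _; rewrite lee_fin sqr_ge0.
  rewrite (eq_measure_integral (measure_add rC rD) (m1 := gam)); last first.
    by move=> X mX _; apply: (etrans (gamDI _ mX)); exact/esym/measure_addE.
  have mc := measurable_sqdist.
  rewrite !ge0_integral_measure_add// !ge0_integral_mscale//.
  rewrite dgE ge0_integral_pushforward//; last by move=> z _; exact: c0.
  rewrite [X in (_ + (_ + _ * X))%E]integral0_eq; last first.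
    by move=> z _; rewrite /= subrr expr0n.
  rewrite mule0 adde0 leeD2r//= -[leRHS]mul1e lee_wpmul2r//.
    exact: integral_ge0.
  by rewrite lee_fin; lra.
Qed.

Lemma transport_exchange (mu nu : meas) (gam : meas2) (f h : R -> R)
    (A : set R) (e : R) :
  has_density Om mu f -> has_density Om nu h ->
  (mu setT < +oo)%E -> (nu setT < +oo)%E ->
  coupling mu nu gam -> measurable A -> 0 < e < 1 ->
  exists (mu' : meas) (g k : R -> R), [/\
    has_density Om mu' (fun x => f x - e * g x + e * k x),
    leb.-integrable Om (EFin \o g) /\
      forall x, Om x -> 0 <= g x <= (f \_ A) x,
    leb.-integrable Om (EFin \o k) /\
      forall x, Om x -> 0 <= k x <= (h \_ (~` A)) x,
    (\int[leb]_(x in Om) (g x)%:E = \int[leb]_(x in Om) (k x)%:E)%E /\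
    (forall E, measurable E -> E `<=` A ->
      mu E <= \int[leb]_(x in E `&` Om) (g x)%:E + nu A)%E &
    mu' setT = nu setT /\
    (W2sq mu' nu <= \int[gam]_z ((z.1 - z.2) ^+ 2)%:E)%E].
Proof.
move=> muf nuh muoo nuoo cpl mA e01.
have [mu' [al [al2 [be [muE mu'E dom [albe out] [mu'T W]]]]]] :=
  transport_exchange_coupling cpl mA e01.
have mA' := measurableC mA.
have restr_oo (m : meas) B (mB : measurable B) : (m setT < +oo)%E ->
    (mrestr m mB setT < +oo)%E.
  by apply: le_lt_trans; apply: le_measure; rewrite ?inE//; exact: measurableI.
have [g alg gf] := dominated_density mOm (has_density_restr mOm mA muf)
  (restr_oo _ _ _ muoo) (fun E mE => (dom E mE).1).
have [k bek kh] := dominated_density mOm (has_density_restr mOm mA' nuh)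
  (restr_oo _ _ _ nuoo) (fun E mE => (dom E mE).2).
have aloo : (al setT < +oo)%E.
  by apply: le_lt_trans muoo; rewrite (muE _ measurableT) leeDl.
have beoo : (be setT < +oo)%E by rewrite -albe.
have ig := has_density_integrable alg aloo.
have ik := has_density_integrable bek beoo.
have if_ := has_density_integrable muf muoo.
have [mf [f0 muf']] := muf.
have [mg [g0 alg']] := alg.
have [mk [k0 bek']] := bek.
exists mu', g, k; split.
- split; [|split].
  + apply: measurable_funD; [apply: measurable_funB => //|];
      by apply: measurable_funM.
  + move=> x Ox; move: e01 => /andP[e0 e1].
    have gx := g0 x Ox; have kx := k0 x Ox; have fx := f0 x Ox.
    have gfx : g x <= f x.
      by apply: (le_trans (gf x Ox)); rewrite patchE; case: ifP.
    have : e * g x <= 1 * g x by rewrite ler_wpM2r// ltW.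
    by have : 0 <= e * k x by [rewrite mulr_ge0// ltW]; lra.
  + move=> E mE; rewrite mu'E.
    have mEO : measurable (E `&` Om) by exact: measurableI.
    have sub u : leb.-integrable Om u -> leb.-integrable (E `&` Om) u.
      by apply: integrableS => //; exact: subIsetr.
    under eq_integral do rewrite EFinD EFinB !EFinM.
    have jf : leb.-integrable (E `&` Om) (fun x => (f x)%:E) by exact: sub.
    have jg : leb.-integrable (E `&` Om) (fun x => (g x)%:E) by exact: sub.
    have jk : leb.-integrable (E `&` Om) (fun x => (k x)%:E) by exact: sub.
    have jeg := integrableZl mEO e jg; have jek := integrableZl mEO e jk.
    rewrite (integralD mEO (integrableB mEO jf jeg) jek).
    rewrite (integralB mEO jf jeg) (integralZl mEO jg) (integralZl mEO jk).
    rewrite -muf'// -alg'// -bek'// muE//.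
    have fin (m : meas) : (m setT < +oo)%E -> m E \is a fin_num.
      move=> moo; rewrite ge0_fin_numE//; apply: le_lt_trans moo.
      by apply: le_measure; rewrite ?inE.
    have al2oo : (al2 setT < +oo)%E.
      by apply: le_lt_trans muoo; rewrite (muE _ measurableT) leeDr.
    rewrite -(fineK (fin _ aloo)) -(fineK (fin _ al2oo)) -(fineK (fin _ beoo)).
    by rewrite -!EFinM -!EFinD; congr EFin; ring.
- by split => // x Ox; rewrite g0// gf.
- by split => // x Ox; rewrite k0// kh.
- split.
    by have := albe; rewrite alg'// bek'// !setTI.
  by move=> E mE EA; rewrite -alg'//; exact: out.
- by [].
Qed.

End Exchange.

(** * Energy estimates *)

Lemma measurable_superlevel d (T : measurableType d) (R : realType) (D : set T)
    (S : T -> R) (L : R) : measurable D -> measurable_fun D S ->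
  measurable (D `&` [set x | L < S x]).
Proof.
move=> mD mS; have := @measurable_fun_ltr _ _ _ D (cst L) S (measurable_cst _) mS.
by move=> /(_ mD [set true]); apply.
Qed.

Lemma normr_between (R : realDomainType) (x y z : R) :
  x <= y -> y <= z -> `|y| <= `|x| + `|z|.
Proof.
move=> xy yz; rewrite ler_norml; apply/andP; split.
  rewrite lerNl (@le_trans _ _ `|x|) ?lerDl//.
  by rewrite -normrN (le_trans _ (ler_norm _))// lerN2.
by rewrite (le_trans yz)// (le_trans (ler_norm z))// lerDr.
Qed.

Section BoundedBelow.
Context d (T : measurableType d) (R : realType) (mu : {measure set T -> \bar R}).
Variables (D : set T) (f : T -> R) (c : R).
Hypotheses (mD : measurable D) (muD : (mu D < +oo)%E).
Hypotheses (mf : measurable_fun D f) (cf : forall x, D x -> c <= f x).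

Lemma integrable_cst_lty : mu.-integrable D (EFin \o cst c).
Proof.
apply/integrableP; split; first exact/measurable_EFinP/measurable_cst.
by rewrite (eq_integral (cst `|c|%:E))// integral_cst// lte_mul_pinfty.
Qed.

Lemma integrable_bounded_below :
  (\int[mu]_(x in D) (f x)%:E < +oo)%E -> mu.-integrable D (EFin \o f).
Proof.
move=> foo; have mF : measurable_fun D (EFin \o f) by exact/measurable_EFinP.
have mFp := measurable_funepos mF; have mFn := measurable_funeneg mF.
have negoo : (\int[mu]_(x in D) (EFin \o f)^\- x < +oo)%E.
  apply: (@le_lt_trans _ _ (\int[mu]_(x in D) (cst `|c|%:E) x)%E).
    apply: ge0_le_integral => // x Dx; rewrite funenegE/= ge_max !lee_fin.
    by rewrite normr_ge0 andbT -normrN (le_trans _ (ler_norm _))// lerN2 cf.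
  by rewrite integral_cst// lte_mul_pinfty.
have negfin : (\int[mu]_(x in D) (EFin \o f)^\- x)%E \is a fin_num.
  by rewrite ge0_fin_numE//; exact: integral_ge0.
have posoo : (\int[mu]_(x in D) (EFin \o f)^\+ x < +oo)%E.
  by move: foo; rewrite integralE lteBlDr// => /lt_le_trans; apply; rewrite leey.
apply/integrableP; split => //.
rewrite (eq_integral ((EFin \o f)^\+ \+ (EFin \o f)^\-)%E).
  by rewrite ge0_integralD//; exact: lte_add_pinfty.
by move=> x _; exact: (congr1 (@^~ x) (fune_abse (EFin \o f))).
Qed.

Lemma integral_bounded_below : (c%:E * mu D <= \int[mu]_(x in D) (f x)%:E)%E.
Proof.
have [/integrable_bounded_below fi|] := ltP (\int[mu]_(x in D) (f x)%:E)%E +oo%E;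
  last by rewrite leye_eq => /eqP ->; rewrite leey.
rewrite -integral_cst//; apply: le_integral => //.
  exact: integrable_cst_lty.
by move=> x /[!inE] Dx /=; rewrite lee_fin cf.
Qed.

End BoundedBelow.

Section Energy.
Context {R : realType}.
Local Notation leb := (@lebesgue_measure R).
Local Notation meas := {measure set (measurableTypeR R) -> \bar R}.
Variables (Om : set R) (chi : R -> R).
Hypothesis mOm : measurable Om.
Hypothesis Omoo : (leb Om < +oo)%E.
Hypothesis chiP : chi_admissible chi.

Lemma measurable_chi_comp (S : R -> R) : measurable_fun Om S ->
  (forall x, Om x -> 0 <= S x) -> measurable_fun Om (chi \o S).
Proof.
move=> mS S0.
refine (@measurable_comp _ _ _ R R R `[0, +oo[%classic chi Om S _ _ _ _) => //.
- by move=> _ [x Ox <-]/=; rewrite in_itv/= andbT S0.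
- by apply: subspace_continuous_measurable_fun => //; case: chiP.
Qed.

Lemma has_density_unique (mu : meas) f g : has_density Om mu f ->
  has_density Om mu g -> (mu setT < +oo)%E ->
  ae_eq leb Om (EFin \o f) (EFin \o g).
Proof.
move=> muf [mg [_ mug]] muoo; apply: integral_ae_eq => //.
- exact: has_density_integrable muf muoo.
- exact/measurable_EFinP.
- case: muf => _ [_ muf] E EO mE.
  by have := mug _ mE; rewrite muf// (setIidl EO).
Qed.

Lemma energy_density (rho eta : meas) f1 f2 :
  has_density Om rho f1 -> has_density Om eta f2 ->
  (rho setT < +oo)%E -> (eta setT < +oo)%E ->
  energy chi Om rho eta = (\int[leb]_(x in Om) (chi (f1 x + f2 x))%:E)%E.
Proof.
move=> rf ef roo eoo; have meas_chi u v : has_density Om rho u ->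
    has_density Om eta v -> measurable_fun Om (fun x => (chi (u x + v x))%:E).
  move=> [mu [u0 _]] [mv [v0 _]]; apply/measurable_EFinP.
  apply: (@measurable_chi_comp (u \+ v)); first exact: measurable_funD.
  by move=> x Ox; rewrite addr_ge0 ?u0 ?v0.
rewrite /energy [X in ereal_inf X](_ : _ =
  [set (\int[leb]_(x in Om) (chi (f1 x + f2 x))%:E)%E]).
  by rewrite ereal_inf1.
apply/seteqP; split => [_ [[u v] [/= ru ev] <-]|_ ->]; last by exists (f1, f2).
apply: ae_eq_integral => //; [exact: meas_chi..|].
have := has_density_unique ru rf roo; have := has_density_unique ev ef eoo.
apply: filterS2 => x + + Ox => /(_ Ox) [->] /(_ Ox) [->].
by [].
Qed.

Lemma energy_ge (rho eta : meas) : ((chi 0)%:E * leb Om <= energy chi Om rho eta)%E.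
Proof.
apply: le_ereal_inf_tmp => _ [[u v] [[/= mu [u0 _]] [mv [v0 _]]] <-].
apply: integral_bounded_below => //.
  apply: (@measurable_chi_comp (u \+ v)); first exact: measurable_funD.
  by move=> x Ox; rewrite addr_ge0 ?u0 ?v0.
by move=> x Ox; apply: (chi_le chiP) => //; rewrite addr_ge0 ?u0 ?v0.
Qed.

Lemma energy_drop (S G H : R -> R) (L L' e c m : R) :
  0 < L -> L < L' -> 0 < e < 1 -> measurable_fun Om S ->
  leb.-integrable Om (EFin \o (chi \o S)) ->
  leb.-integrable Om (EFin \o G) -> leb.-integrable Om (EFin \o H) ->
  (forall x, Om x -> 0 <= G x <= S x /\ 0 <= H x <= L) ->
  (forall x, Om x -> (S x <= L -> G x = 0) /\ (L < S x -> H x = 0)) ->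
  \int[leb]_(x in Om) G x = \int[leb]_(x in Om) H x ->
  \int[leb]_(x in Om) G x <= m ->
  c <= \int[leb]_(x in Om `&` [set x | L' < S x]) G x ->
  (\int[leb]_(x in Om) (chi (S x - e * G x + e * H x))%:E <=
   (\int[leb]_(x in Om) (chi (S x)) -
    e * ((derive1 chi ((1 - e) * L') - derive1 chi ((1 - e) * L)) * c -
         (derive1 chi ((1 + e) * L) - derive1 chi ((1 - e) * L)) * m))%:E)%E.
Proof.
move=> L0 LL' e01 mS iS iG iH bnd supp GH Gm cG.
(* [R] and [measurableTypeR R] carry the same sets but different displays. *)
have mOmR : measurable (Om : set (measurableTypeR R)) by exact: mOm.
have /andP[e0 e1] := e01.
have mG : measurable_fun Om G by apply/measurable_EFinP; exact: measurable_int iG.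
have mH : measurable_fun Om H by apply/measurable_EFinP; exact: measurable_int iH.
have [p0 p0E] : exists p0 : R, p0 = derive1 chi ((1 - e) * L) by eexists.
have [p pE] : exists p : R, p = derive1 chi ((1 + e) * L) by eexists.
have [q qE] : exists q : R, q = derive1 chi ((1 - e) * L') by eexists.
rewrite -p0E -pE -qE.
have S'0 x : Om x -> 0 <= S x - e * G x + e * H x.
  move=> /bnd[/andP[Gx GS] /andP[Hx _]].
  have : e * G x <= 1 * G x by rewrite ler_wpM2r// ltW.
  by have : 0 <= e * H x by [rewrite mulr_ge0// ltW]; lra.
have mS' : measurable_fun Om (fun x => S x - e * G x + e * H x).
  by apply: measurable_funD; [apply: measurable_funB => //|];
    apply: measurable_funM.
have mB : measurable (Om `&` [set x | L' < S x]).
  exact: measurable_superlevel.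
pose GB := G \_ (Om `&` [set x | L' < S x]).
have iGB : leb.-integrable Om (EFin \o GB).
  apply: le_integrable iG => //.
    apply/measurable_EFinP/measurable_restrict => //.
    by apply: measurable_funS mG => //; exact: subIsetl.
  by move=> x Ox /=; rewrite /GB patchE; case: ifP => // _; rewrite normr0 lee_fin.
have GBE x : Om x -> GB x = G x * (L' < S x)%R%:R.
  move=> Ox; rewrite /GB patchE; case: ltP => LS.
    by rewrite mem_set ?mulr1.
  by rewrite memNset ?mulr0// => -[_ /=]; rewrite ltNge LS.
have IGB : \int[leb]_(x in Om `&` [set x | L' < S x]) G x = \int[leb]_(x in Om) GB x.
  by rewrite /GB -Rintegral_mkcondr setIA setIid.
have pw x : Om x -> chi (S x - e * G x + e * H x)
    + e * ((q - p0) * GB x + p0 * G x) <= chi (S x) + e * (p * H x).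
  move=> Ox; rewrite GBE//; have [/andP[? ?] /andP[? ?]] := bnd _ Ox.
  by have [? ?] := supp _ Ox; rewrite p0E pE qE; exact: chi_exchange.
have p00 : 0 < p0 by rewrite p0E; apply: (dchi_gt0 chiP); rewrite mulr_gt0// subr_gt0.
have p0p : p0 <= p.
  rewrite p0E pE; apply: (dchi_le chiP); first by rewrite mulr_gt0// subr_gt0.
  by rewrite ler_pM2r// lerD2l (le_trans _ (ltW e0))// oppr_le0 ltW.
have p0q : p0 <= q.
  rewrite p0E qE; apply: (dchi_le chiP); first by rewrite mulr_gt0// subr_gt0.
  by rewrite ler_pM2l ?subr_gt0// ltW.
have iZ k u : leb.-integrable Om (EFin \o u) ->
    leb.-integrable Om (EFin \o (fun x => k * u x)).
  by move=> iu; apply: eq_integrable (integrableZl mOmR k iu).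
have iD u v : leb.-integrable Om (EFin \o u) -> leb.-integrable Om (EFin \o v) ->
    leb.-integrable Om (EFin \o (fun x => u x + v x)).
  by move=> iu iv; apply: eq_integrable (integrableD mOmR iu iv).
have iR : leb.-integrable Om (EFin \o (fun x => chi (S x) + e * (p * H x))).
  by apply: iD => //; apply/iZ/iZ.
have iT : leb.-integrable Om (EFin \o (fun x => e * ((q - p0) * GB x + p0 * G x))).
  by apply/iZ/iD; exact: iZ.
have iS' : leb.-integrable Om (EFin \o (fun x => chi (S x - e * G x + e * H x))).
  have i0 := iD _ _ (integrable_norm (integrable_cst_lty (chi 0) mOmR Omoo))
    (integrable_norm iR).
  apply: le_integrable i0 => //.
    by apply/measurable_EFinP; exact: (measurable_chi_comp mS').
  move=> x Ox /=; rewrite lee_fin [leRHS]ger0_norm; last by rewrite addr_ge0.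
  apply: normr_between.
    by apply: (chi_le chiP) => //; exact: S'0.
  apply: le_trans (pw _ Ox); rewrite lerDl.
  have [/andP[Gx _] _] := bnd _ Ox; rewrite mulr_ge0 ?(ltW e0)// addr_ge0//.
    by rewrite GBE// !mulr_ge0// subr_ge0.
  by rewrite mulr_ge0// ltW.
have := le_Rintegral mOmR (iD _ _ iS' iT) iR pw.
rewrite !RintegralD//; [|by apply/iZ/iZ].
rewrite !RintegralZl//; [|exact: iZ|by apply: iD; exact: iZ].
rewrite RintegralD//; [|exact: iZ..].
rewrite !RintegralZl// -GH -IGB => ineq.
rewrite -[leLHS]fineK; last exact: integrable_fin_num.
rewrite lee_fin -/(Rintegral _ _ _).
set IG := (X in _ <= X) in cG; move: ineq cG Gm; rewrite -/IG.
set N := \int[leb]_(x in Om) G x => ineq cG Gm.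
have h1 : (q - p0) * c <= (q - p0) * IG by rewrite ler_wpM2l// subr_ge0.
have h2 : (p - p0) * N <= (p - p0) * m by rewrite ler_wpM2l// subr_ge0.
have : e * ((q - p0) * c - (p - p0) * m) <= e * ((q - p0) * IG - (p - p0) * N).
  by rewrite ler_pM2l//; lra.
lra.
Qed.

End Energy.

(** * The density of a minimiser *)

Lemma superlevel_excess d (T : measurableType d) (R : realType)
    (mu : {measure set T -> \bar R}) (D : set T) (S h : T -> R) (L : R) :
  measurable D -> mu.-integrable D (EFin \o S) -> mu.-integrable D (EFin \o h) ->
  (forall x, D x -> 0 <= S x) -> (forall x, D x -> h x <= L) ->
  mu (D `&` [set x | L < S x]) != 0%E ->
  exists2 L', L < L' & (\int[mu]_(x in D `&` [set x | (L < S x)%R]) (h x)%:E <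
    \int[mu]_(x in D `&` [set x | (L' < S x)%R]) (S x)%:E)%E.
Proof.
move=> mD iS ih S0 hL; apply: contra_neqP => nex.
set A := D `&` _; pose F k := D `&` [set x | L + k.+1%:R^-1 < S x].
have mS : measurable_fun D S by apply/measurable_EFinP; exact: measurable_int iS.
have mF k : measurable (F k) by exact: measurable_superlevel.
have mA : measurable A by exact: measurable_superlevel.
have AD : A `<=` D by exact: subIsetl.
have AE : A = \bigcup_k F k.
  apply/seteqP; split => [x [Dx /= /ltr_add_invr[k Lk]]|x [k _ [Dx /= Lk]]].
    by exists k.
  by split => //=; apply: lt_trans Lk; rewrite ltrDl.
have cvgF : (\int[mu]_(x in F k) (S x)%:E @[k --> \oo] -->
    \int[mu]_(x in \bigcup_k F k) (S x)%:E)%E.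
  apply: ge0_nondecreasing_set_cvg_integral => //.
  - move=> i j ij; apply/subsetPset => x [Dx /= Lx]; split => //=.
    by apply: le_lt_trans Lx; rewrite lerD2l lef_pV2 ?posrE// ler_nat.
  - move=> i; apply/measurable_EFinP; apply: measurable_funS mS => //.
    exact: subIsetl.
  - by move=> i x [Dx _]; rewrite lee_fin S0.
have iSA := integrableS mD mA AD iS; have ihA := integrableS mD mA AD ih.
have SlehA : (\int[mu]_(x in A) (S x)%:E <= \int[mu]_(x in A) (h x)%:E)%E.
  rewrite [in leLHS]AE; apply: cvge_to_le cvgF _; apply: nearW => k.
  rewrite leNgt; apply/negP => lt; apply: nex.
  by exists (L + k.+1%:R^-1) => //; rewrite ltrDl.
have iB := integrableB mA iSA ihA.
have Sh x : A x -> (h x < S x)%R by move=> [Dx /=]; apply: le_lt_trans; exact: hL.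
have int0 : (\int[mu]_(x in A) `|((EFin \o S) \- (EFin \o h)) x| = 0)%E.
  rewrite (eq_integral ((EFin \o S) \- (EFin \o h))%E); last first.
    by move=> x /[!inE] Ax /=; rewrite ger0_norm// subr_ge0 ltW// Sh.
  apply/eqP; rewrite eq_le; apply/andP; split; last first.
    by apply: integral_ge0 => x Ax /=; rewrite lee_fin subr_ge0 ltW// Sh.
  rewrite (integralB mA iSA ihA) leeBlDr ?add0e//.
  exact: (integrable_fin_num mA ihA).
have [N [mN N0 NA]] := (ae_eq_integral_abs mu mA (measurable_int _ iB)).1 int0.
apply/eqP; rewrite eq_le measure_ge0 andbT -N0; apply: le_measure; rewrite ?inE//.
move=> x Ax; apply: NA => /= /(_ Ax) [] /eqP; rewrite subr_eq0 => /eqP e.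
by have := Sh _ Ax; rewrite e ltxx.
Qed.

Section Minimizer.
Context {R : realType}.
Local Notation leb := (@lebesgue_measure R).
Local Notation meas := {measure set (measurableTypeR R) -> \bar R}.
Variables (Om : set R) (chi : R -> R).
Hypothesis mOm : measurable Om.
Hypothesis Omoo : (leb Om < +oo)%E.
Hypothesis chiP : chi_admissible chi.

Lemma minimizer_density_le (tau L m1 m2 : R) (rh eh rho eta : meas)
    (f1 f2 h1 h2 : R -> R) :
  0 < tau -> 0 < L ->
  has_density Om rho f1 -> has_density Om eta f2 ->
  has_density Om rh h1 -> has_density Om eh h2 ->
  (forall x, Om x -> h1 x + h2 x <= L) ->
  rh setT = m1%:E -> eh setT = m2%:E ->
  W2sq rho rh \is a fin_num -> W2sq eta eh \is a fin_num ->
  energy chi Om rho eta \is a fin_num ->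
  diffusion_minimizer tau chi Om m1 m2 rh eh rho eta ->
  leb (Om `&` [set x | L < f1 x + f2 x]) = 0%E.
Proof.
move=> tau0 L0 rf1 ef2 rh1 eh2 hL rhT ehT W1fin W2fin Efin [rhoP [etaP mini]].
have mOmR : measurable (Om : set (measurableTypeR R)) by exact: mOm.
have massT (mu : meas) f m : has_density Om mu f -> in_Pm Om m mu -> mu setT = m%:E.
  by move=> [_ [_ muE]] [_ <-]; rewrite !muE// setTI setIid.
have rhoT := massT _ _ _ rf1 rhoP; have etaT := massT _ _ _ ef2 etaP.
have oo (mu : meas) m : mu setT = m%:E -> (mu setT < +oo)%E.
  by move=> ->; rewrite ltry.
have iD u v : leb.-integrable Om (EFin \o u) -> leb.-integrable Om (EFin \o v) ->
    leb.-integrable Om (EFin \o (u \+ v)).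
  by move=> iu iv; apply: eq_integrable (integrableD mOmR iu iv).
have if1 := has_density_integrable rf1 (oo _ _ rhoT).
have if2 := has_density_integrable ef2 (oo _ _ etaT).
have ih1 := has_density_integrable rh1 (oo _ _ rhT).
have ih2 := has_density_integrable eh2 (oo _ _ ehT).
have [mf1 [f10 rhoE]] := rf1; have [mf2 [f20 etaE]] := ef2.
have [mh1 [h10 rhE]] := rh1; have [mh2 [h20 ehE]] := eh2.
pose S := f1 \+ f2.
have mS : measurable_fun Om S by exact: measurable_funD.
have S0 x : Om x -> 0 <= S x by move=> Ox; rewrite addr_ge0 ?f10 ?f20.
apply/eqP/negPn/negP => A0.
(* [L'] keeps the gain in [chi'] uniform over all couplings. *)
have [L' LL' exc] := superlevel_excess mOmR (iD _ _ if1 if2) (iD _ _ ih1 ih2) S0 hL A0.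
set A := (X in (integral _ X _ < _)%E) in exc.
set B := (X in (_ < integral _ X _)%E) in exc.
have mA : measurable A by exact: measurable_superlevel.
have mB : measurable B by exact: measurable_superlevel.
have BA : B `<=` A by move=> x [Ox /= LS]; split => //=; exact: lt_trans LS.
have AO : A `<=` Om by exact: subIsetl.
have BO : B `<=` Om by exact: subIsetl.
have addE (mu nu : meas) u v E : has_density Om mu u -> has_density Om nu v ->
    measurable E -> E `<=` Om ->
    (\int[leb]_(x in E) (u x + v x)%:E = mu E + nu E)%E.
  move=> [mu_ [u0 muE]] [mv [v0 nuE]] mE EO.
  rewrite muE// nuE// (setIidl EO).
  under eq_integral do rewrite EFinD.
  rewrite ge0_integralD//.
  - by move=> x /EO Ox; rewrite lee_fin u0.
  - by apply/measurable_EFinP; exact: measurable_funS mu_.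
  - by move=> x /EO Ox; rewrite lee_fin v0.
  - by apply/measurable_EFinP; exact: measurable_funS mv.
rewrite (addE rh eh)// (addE rho eta)// in exc.
have fin (mu : meas) m E : measurable E -> mu setT = m%:E -> mu E \is a fin_num.
  move=> mE muT; rewrite ge0_fin_numE//; apply: le_lt_trans (oo _ _ muT).
  by apply: le_measure; rewrite ?inE.
pose c := fine (rho B) + fine (eta B) - (fine (rh A) + fine (eh A)).
have c0 : 0 < c.
  move: exc; rewrite -(fineK (fin _ _ _ mA rhT)) -(fineK (fin _ _ _ mA ehT)).
  rewrite -(fineK (fin _ _ _ mB rhoT)) -(fineK (fin _ _ _ mB etaT)).
  by rewrite -!EFinD lte_fin subr_gt0.
have [e e01 gap] := dchi_gap chiP (m1 + m2) L0 LL' c0.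
have /andP[e0 e1] := e01.
have [K [K0 KE]] : exists K : R, 0 < K /\ K =
    e * ((derive1 chi ((1 - e) * L') - derive1 chi ((1 - e) * L)) * c -
         (derive1 chi ((1 + e) * L) - derive1 chi ((1 - e) * L)) * (m1 + m2)).
  by eexists; split; last reflexivity; rewrite mulr_gt0// subr_gt0.
have d0 : 0 < tau * K / 2 by rewrite divr_gt0// mulr_gt0.
have [_ [g1 cpl1 <-] lt1] := lb_ereal_inf_adherent d0 W1fin.
have [_ [g2 cpl2 <-] lt2] := lb_ereal_inf_adherent d0 W2fin.
have [rho' [u1 [k1 [rho'D [iu1 u1P] [ik1 k1P] [uk1 out1] [rho'T Wr]]]]] :=
  transport_exchange mOm rf1 rh1 (oo _ _ rhoT) (oo _ _ rhT) cpl1 mA e01.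
have [eta' [u2 [k2 [eta'D [iu2 u2P] [ik2 k2P] [uk2 out2] [eta'T We]]]]] :=
  transport_exchange mOm ef2 eh2 (oo _ _ etaT) (oo _ _ ehT) cpl2 mA e01.
rewrite rhT in rho'T; rewrite ehT in eta'T.
have inP (mu : meas) f m : has_density Om mu f -> mu setT = m%:E -> in_Pm Om m mu.
  move=> muf muT; split.
    by rewrite -setTD; exact: (has_density_out mOm muf measurableT).
  by move: muf => [_ [_ muE]]; rewrite -muT !muE// setTI setIid.
have obj_le := mini _ _ (inP _ _ _ rho'D rho'T) (inP _ _ _ eta'D eta'T).
pose G := u1 \+ u2; pose H := k1 \+ k2.
have patch_le (f : R -> R) (D : set R) x : 0 <= f x -> (f \_ D) x <= f x.
  by rewrite patchE; case: ifP.
have bnd x : Om x -> 0 <= G x <= S x /\ 0 <= H x <= L.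
  move=> Ox; have /andP[u10 u1f] := u1P _ Ox; have /andP[u20 u2f] := u2P _ Ox.
  have /andP[k10 k1h] := k1P _ Ox; have /andP[k20 k2h] := k2P _ Ox.
  rewrite /G /H /S/= !addr_ge0//=; split.
    by apply: lerD; [apply: le_trans u1f _|apply: le_trans u2f _];
      apply: patch_le; [exact: f10|exact: f20].
  apply: le_trans (hL _ Ox).
  by apply: lerD; [apply: le_trans k1h _|apply: le_trans k2h _];
    apply: patch_le; [exact: h10|exact: h20].
have supp x : Om x -> (S x <= L -> G x = 0) /\ (L < S x -> H x = 0).
  move=> Ox; have := u1P _ Ox; have := u2P _ Ox; have := k1P _ Ox; have := k2P _ Ox.
  rewrite /G /H/= !patchE => k2x k1x u2x u1x; split => SL.
    have xA : (x \in A) = false by rewrite memNset// => -[_ /=]; rewrite ltNge SL.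
    move: u1x u2x; rewrite xA -!eq_le => /eqP <- /eqP <-; exact: addr0.
  have xA : (x \in ~` A) = false by rewrite memNset//; apply; split.
  move: k1x k2x; rewrite xA -!eq_le => /eqP <- /eqP <-; exact: addr0.
have iG : leb.-integrable Om (EFin \o G) by exact: iD.
have iH : leb.-integrable Om (EFin \o H) by exact: iD.
have GH : \int[leb]_(x in Om) G x = \int[leb]_(x in Om) H x.
  rewrite (RintegralD mOmR iu1 iu2) (RintegralD mOmR ik1 ik2).
  by rewrite /Rintegral uk1 uk2.
have Gm : \int[leb]_(x in Om) G x <= m1 + m2.
  rewrite (RintegralD mOmR iu1 iu2).
  have -> : m1 = \int[leb]_(x in Om) f1 x.
    by have := rhoT; rewrite rhoE// setTI /Rintegral => ->.
  have -> : m2 = \int[leb]_(x in Om) f2 x.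
    by have := etaT; rewrite etaE// setTI /Rintegral => ->.
  apply: lerD; apply: le_Rintegral => // x Ox.
    by have /andP[_ /le_trans] := u1P _ Ox; apply; apply: patch_le; exact: f10.
  by have /andP[_ /le_trans] := u2P _ Ox; apply; apply: patch_le; exact: f20.
have cG : c <= \int[leb]_(x in B) G x.
  have ju1 := integrableS mOmR mB BO iu1; have ju2 := integrableS mOmR mB BO iu2.
  rewrite (RintegralD mB ju1 ju2) /c.
  have le_fine (mu nu : meas) m n u : mu setT = m%:E -> nu setT = n%:E ->
      leb.-integrable B (EFin \o u) ->
      (mu B <= \int[leb]_(x in B) (u x)%:E + nu A)%E ->
      fine (mu B) <= \int[leb]_(x in B) u x + fine (nu A).
    move=> muT nuT ju; rewrite -(fineK (fin _ _ _ mB muT)).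
    rewrite -(fineK (fin _ _ _ mA nuT)) -(fineK (integrable_fin_num mB ju)).
    by rewrite -EFinD lee_fin.
  have := le_fine _ _ _ _ _ rhoT rhT ju1; have := le_fine _ _ _ _ _ etaT ehT ju2.
  have := out1 _ mB BA; have := out2 _ mB BA; rewrite !(setIidl BO).
  move=> o2 o1 /(_ o2) q2 /(_ o1) q1.
  rewrite lerBlDr (le_trans (lerD q1 q2))//.
  by rewrite le_eqVlt; apply/orP; left; apply/eqP; ring.
have EE := energy_density mOm chiP rf1 ef2 (oo _ _ rhoT) (oo _ _ etaT).
have iS : leb.-integrable Om (EFin \o (chi \o S)).
  apply: (integrable_bounded_below (c := chi 0)) => //.
  - exact: measurable_chi_comp.
  - by move=> x Ox; apply: (chi_le chiP) => //; exact: S0.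
  - by move: Efin; rewrite EE fin_numElt => /andP[].
have := energy_drop mOm Omoo chiP L0 LL' e01 mS iS iG iH bnd supp GH Gm cG.
rewrite -KE => drop.
have E'le : (energy chi Om rho' eta' <= energy chi Om rho eta - K%:E)%E.
  rewrite (energy_density mOm chiP rho'D eta'D (oo _ _ rho'T) (oo _ _ eta'T)).
  apply: le_trans (_ : _ <= _)%E (le_trans drop _).
    rewrite le_eqVlt; apply/orP; left; apply/eqP; apply: eq_integral => x _.
    by congr (EFin (chi _)); rewrite /S /G /H/=; ring.
  by rewrite EE EFinB /Rintegral (fineK (integrable_fin_num mOmR iS)).
have W'le : (W2sq rho' rh + W2sq eta' eh <= W2sq rho rh + W2sq eta eh + (tau * K)%:E)%E.
  have le1 : (W2sq rho' rh <= W2sq rho rh + (tau * K / 2)%:E)%E.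
    exact: le_trans Wr (ltW lt1).
  have le2 : (W2sq eta' eh <= W2sq eta eh + (tau * K / 2)%:E)%E.
    exact: le_trans We (ltW lt2).
  apply: (le_trans (leeD le1 le2)).
  rewrite -(fineK W1fin) -(fineK W2fin) -!EFinD lee_fin; lra.
have t0 : 0 < (2 * tau)^-1 by rewrite invr_gt0 mulr_gt0.
have : (diffusion_obj tau chi Om rh eh rho' eta' <
        diffusion_obj tau chi Om rh eh rho eta)%E; last by rewrite ltNge obj_le.
rewrite /diffusion_obj.
apply: (@le_lt_trans _ _ (((2 * tau)^-1)%:E *
    (W2sq rho rh + W2sq eta eh + (tau * K)%:E) + (energy chi Om rho eta - K%:E))%E).
  by apply: leeD => //; rewrite lee_pmul2l.
rewrite -(fineK W1fin) -(fineK W2fin) -(fineK Efin).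
rewrite -[ltLHS]/(((2 * tau)^-1 *
  (fine (W2sq rho rh) + fine (W2sq eta eh) + tau * K) + (fine (energy chi Om rho eta) - K))%:E).
rewrite -[ltRHS]/(((2 * tau)^-1 *
  (fine (W2sq rho rh) + fine (W2sq eta eh)) + fine (energy chi Om rho eta))%:E).
rewrite lte_fin.
rewrite mulrDr -addrA ltrD2l.
have -> : (2 * tau)^-1 * (tau * K) = K / 2 by field; rewrite gt_eqF.
lra.
Qed.

End Minimizer.

(** * Bounds after the diffusion step *)

(** Typeclass search does not recover the measure structure when [{ae _, _}] is
    applied to the bare function [lebesgue_measure]. *)
#[local] Instance leb_ae_filter (R : realType) :
  Filter (nbhs (almost_everywhere (@lebesgue_measure R))).
Proof. exact: (ae_filter_ringOfSetsType (@lebesgue_measure R)). Qed.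

Section Step.
Context {R : realType}.
Local Notation leb := (@lebesgue_measure R).
Local Notation meas := {measure set (measurableTypeR R) -> \bar R}.

Lemma W2sq_ge0 (mu nu : meas) : (0 <= W2sq mu nu)%E.
Proof.
apply: le_ereal_inf_tmp => _ [g _ <-]; apply: integral_ge0 => z _.
by rewrite lee_fin sqr_ge0.
Qed.

Lemma W2sq_diag (mu : meas) : W2sq mu mu = 0%E.
Proof.
apply/eqP; rewrite eq_le W2sq_ge0 andbT.
have mdiag : measurable_fun setT (fun x : measurableTypeR R => (x, x)).
  by apply: measurable_fun_pair; exact: measurable_id.
have [g gE] := pushforward_measure mu mdiag.
apply: ereal_inf_le; exists (\int[g]_z ((z.1 - z.2) ^+ 2)%:E)%E.
  by exists g => //; split => A mA; rewrite gE.
rewrite gE ge0_integral_pushforward//.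
- by rewrite integral0_eq// => x _ /=; rewrite subrr expr0n.
- exact: measurable_sqdist.
- by move=> z _; rewrite lee_fin sqr_ge0.
Qed.

Lemma Linf_norm_lt (Om : set R) (f : R -> R) (L : R) :
  (Linf_norm Om f < L%:E)%E -> {ae leb, forall x, Om x -> `|f x| <= L}.
Proof.
move=> /ereal_inf_lt[M fM ML]; apply: filterS fM => x fM Ox.
by rewrite -lee_fin (le_trans (fM Ox))// ltW.
Qed.

Lemma Linf_norm_ge0 (Om : set R) (f : R -> R) : measurable Om ->
  leb Om != 0%E -> (0 <= Linf_norm Om f)%E.
Proof.
move=> mOm Om0; apply: le_ereal_inf_tmp => M [N [mN N0 fMN]].
rewrite leNgt; apply/negP => M0; move/eqP: Om0; apply.
apply/eqP; rewrite eq_le measure_ge0 andbT -N0; apply: le_measure; rewrite ?inE//.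
move=> x Ox; apply: fMN => /= /(_ Ox) fM; have := le_lt_trans fM M0.
by rewrite lte_fin ltNge normr_ge0.
Qed.

Variable Om : set R.
Hypothesis mOm : measurable Om.

Lemma has_density_ae (mu : meas) (f h : R -> R) :
  measurable_fun Om f -> measurable_fun Om h -> (forall x, Om x -> 0 <= h x) ->
  {ae leb, forall x, Om x -> f x = h x} ->
  (forall A, measurable A -> mu A = (\int[leb]_(x in A `&` Om) (f x)%:E)%E) ->
  has_density Om mu h.
Proof.
move=> mf mh h0 fh muE; split => //; split => // A mA; rewrite muE//.
apply: ae_eq_integral => //.
- exact: measurableI.
- by apply/measurable_EFinP; apply: measurable_funS mf => //; exact: subIsetr.
- by apply/measurable_EFinP; apply: measurable_funS mh => //; exact: subIsetr.
- by apply: filterS fh => x fh [_ Ox] /=; rewrite fh.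
Qed.

Definition clip (u v x : R) := Num.min v (Num.max u x).

Lemma measurable_clip (u v : R) f : measurable_fun Om f ->
  measurable_fun Om (clip u v \o f).
Proof.
move=> mf; apply: measurable_minr; first exact: measurable_cst.
by apply: measurable_maxr => //; exact: measurable_cst.
Qed.

Lemma clip_bounds (u v x : R) : u <= v -> u <= clip u v x <= v.
Proof. by move=> uv; rewrite /clip le_min uv le_max lexx/= ge_min lexx. Qed.

Lemma clip_id (u v x : R) : u <= x <= v -> clip u v x = x.
Proof. by move=> /andP[ux xv]; rewrite /clip max_r// min_r. Qed.

Lemma splitting_densities (r sigma : R -> R) (rh eh : meas) (L : R) :
  0 <= L -> measurable_fun Om sigma -> measurable_fun Om r ->
  {ae leb, forall x, Om x -> 0 <= sigma x} ->
  {ae leb, forall x, Om x -> `|sigma x| <= L} ->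
  {ae leb, forall x, Om x -> 0 <= r x <= 1} ->
  (forall A, measurable A ->
     rh A = (\int[leb]_(x in A `&` Om) (r x * sigma x)%:E)%E) ->
  (forall A, measurable A ->
     eh A = (\int[leb]_(x in A `&` Om) ((1 - r x) * sigma x)%:E)%E) ->
  exists h1 h2, [/\ has_density Om rh h1, has_density Om eh h2 &
    forall x, Om x -> h1 x + h2 x <= L].
Proof.
move=> L0 ms mr s0 sL r01 rhE ehE.
pose s' := clip 0 L \o sigma; pose r' := clip 0 1 \o r.
have ms' : measurable_fun Om s' by exact: measurable_clip.
have mr' : measurable_fun Om r' by exact: measurable_clip.
have s'P x : 0 <= s' x <= L by exact: clip_bounds.
have r'P x : 0 <= r' x <= 1 by exact: clip_bounds.
have mC (q : R -> R) : measurable_fun Om q -> measurable_fun Om (fun x => 1 - q x).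
  by move=> mq; apply: measurable_funB.
have rs' : {ae leb, forall x, Om x -> r x = r' x /\ sigma x = s' x}.
  apply: filterS3 s0 sL r01 => x s0 sL r01 Ox.
  split; apply/esym/clip_id; first exact: r01.
  by rewrite s0//= (le_trans (ler_norm _))// sL.
exists (fun x => r' x * s' x), (fun x => (1 - r' x) * s' x); split.
- apply: has_density_ae rhE; [exact: measurable_funM..| |].
    by move=> x _; have /andP[? _] := s'P x; have /andP[? _] := r'P x; rewrite mulr_ge0.
  by apply: filterS rs' => x rs' Ox; have [<- <-] := rs' Ox.
- apply: has_density_ae ehE; [by apply: measurable_funM => //; exact: mC..| |].
    move=> x _; have /andP[? _] := s'P x; have /andP[_ ?] := r'P x.
    by rewrite mulr_ge0// subr_ge0.
  by apply: filterS rs' => x rs' Ox; have [<- <-] := rs' Ox.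
- by move=> x _; rewrite -mulrDl addrC subrK mul1r; have /andP[] := s'P x.
Qed.

End Step.

Theorem mainTheorem7 (R : realType) (a b : R) (chi : R -> R) (tau : R)
    (r sigma : R -> R) (m1 m2 : R)
    (rh eh rho eta : {measure set (measurableTypeR R) -> \bar R})
    (T : R -> R) :
  a < b ->
  chi_admissible chi ->
  0 < tau < 1 ->
  (* data of the diffusion step: 0 <= sigma in L^oo, 0 <= r <= 1 *)
  measurable_fun `]a, b[%classic sigma -> measurable_fun `]a, b[%classic r ->
  {ae lebesgue_measure, forall x, `]a, b[%classic x -> 0 <= sigma x} ->
  (Linf_norm `]a, b[%classic sigma < +oo)%E ->
  {ae lebesgue_measure, forall x, `]a, b[%classic x -> 0 <= r x <= 1} ->
  (* rho^{n+1/2} = r sigma,  eta^{n+1/2} = (1 - r) sigma  on Omega *)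
  (forall A, measurable A ->
     rh A = (\int[lebesgue_measure]_(x in A `&` `]a, b[%classic) (r x * sigma x)%:E)%E) ->
  (forall A, measurable A ->
     eh A = (\int[lebesgue_measure]_(x in A `&` `]a, b[%classic)
               ((1 - r x) * sigma x)%:E)%E) ->
  rh `]a, b[%classic = m1%:E -> eh `]a, b[%classic = m2%:E ->
  (* (rho^{n+1}, eta^{n+1}) is a minimiser of the diffusion functional *)
  diffusion_minimizer tau chi `]a, b[%classic m1 m2 rh eh rho eta ->
  (* T: nondecreasing optimal transport map pushing sigma^{n+1} to sigma^{n+1/2} *)
  measurable_fun setT T ->
  (forall x y, `]a, b[%classic x -> `]a, b[%classic y -> x <= y -> T x <= T y) ->
  (forall A, measurable A ->
     measure_add rho eta (T @^-1` A) = measure_add rh eh A) ->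
  (\int[measure_add rho eta]_x ((x - T x) ^+ 2)%:E)%E
     = W2sq (measure_add rho eta) (measure_add rh eh) ->
  (* conclusion: 0 <= sigma^{n+1} <= ||sigma^{n+1/2}||_oo  and  0 <= r^{n+1} <= 1 *)
  (exists s : R -> R,
     measurable_fun `]a, b[%classic s /\
     (forall x, `]a, b[%classic x -> 0 <= s x /\ ((s x)%:E <= Linf_norm `]a, b[%classic sigma)%E) /\
     (forall A, measurable A ->
        measure_add rho eta A =
        (\int[lebesgue_measure]_(x in A `&` `]a, b[%classic) (s x)%:E)%E)) /\
  {ae measure_add rho eta, forall x, 0 <= r (T x) <= 1}.
Proof.
move=> ab chiP /andP[tau0 _] ms mr s0 soo r01 rhE ehE rhm ehm minP mT _ pushT _.
set Om := `]a, b[%classic in ms mr s0 soo r01 rhE ehE rhm ehm minP *.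
have mOm : measurable Om by exact: measurable_itv.
have mOmR : measurable (Om : set (measurableTypeR R)) by exact: mOm.
have lebOm : lebesgue_measure Om = (b - a)%:E.
  by rewrite lebesgue_measure_itv/= lte_fin ab.
have Omoo : (lebesgue_measure Om < +oo)%E by rewrite lebOm ltry.
split; last first.
  move: r01 => [N [mN N0 sub]]; exists (T @^-1` (N `|` ~` Om)); split.
  - rewrite -[X in measurable X]setTI; apply: mT => //.
    by apply: measurableU => //; exact: measurableC.
  - have mU : measurable (N `|` ~` Om) by apply: measurableU => //; exact: measurableC.
    rewrite pushT// measure_addE rhE// ehE//.
    have NOm : (N `|` ~` Om) `&` Om `<=` N by move=> x [[]].
    have mI : measurable ((N `|` ~` Om) `&` Om) by exact: measurableI.
    have I0 : lebesgue_measure ((N `|` ~` Om) `&` Om) = 0%E.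
      apply/eqP; rewrite eq_le measure_ge0 andbT -N0.
      by apply: le_measure; rewrite ?inE.
    rewrite !null_set_integral ?adde0//; apply/measurable_EFinP;
      apply: measurable_funS (_ : measurable_fun Om _) => //;
      by [exact: subIsetr|apply: measurable_funM => //; apply: measurable_funB].
  - move=> x /= nr; have [Ox|nOx] := pselect (Om (T x)); [left|by right].
    by apply: sub => /= /(_ Ox).
have Minf0 : (0 <= Linf_norm Om sigma)%E.
  by apply: Linf_norm_ge0 => //; rewrite lebOm eqe subr_eq0 gt_eqF.
have [M ME] : exists M : R, Linf_norm Om sigma = M%:E.
  by exists (fine (Linf_norm Om sigma)); rewrite fineK// ge0_fin_numE.
have M0 : 0 <= M by rewrite -lee_fin -ME.
have dens L : M < L -> exists h1 h2, [/\ has_density Om rh h1, has_density Om eh h2 &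
    forall x, Om x -> h1 x + h2 x <= L].
  move=> ML; apply: splitting_densities ms mr s0 _ r01 rhE ehE => //.
    by rewrite (le_trans M0)// ltW.
  by apply: Linf_norm_lt; rewrite ME lte_fin.
have outOm (mu : {measure set (measurableTypeR R) -> \bar R}) h m :
    has_density Om mu h -> mu Om = m%:E -> in_Pm Om m mu /\ mu setT = m%:E.
  move=> muh muOm; split.
    by split => //; rewrite -setTD; exact: (has_density_out mOm muh measurableT).
  by rewrite -muOm; case: muh => [_ [_ muE]]; rewrite !muE// setTI setIid.
have M1 : M < M + 1 by rewrite ltrDl.
have [h1 [h2 [rh1 eh2 hL]]] := dens _ M1.
have [rhP rhT] := outOm _ _ _ rh1 rhm; have [ehP ehT] := outOm _ _ _ eh2 ehm.
have [rhoP [etaP mini]] := minP.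
have Ehoo : (energy chi Om rh eh < +oo)%E.
  rewrite (energy_density mOm chiP rh1 eh2) ?rhT ?ehT ?ltry//.
  have [mh1 [h10 _]] := rh1; have [mh2 [h20 _]] := eh2.
  have h0 x : Om x -> 0 <= h1 x + h2 x by move=> Ox; rewrite addr_ge0 ?h10 ?h20.
  apply: integrable_lty => //.
  apply: le_integrable (integrable_cst_lty (`|chi 0| + `|chi (M + 1)|) mOmR Omoo) => //.
    apply/measurable_EFinP; apply: (measurable_chi_comp chiP _ h0).
    exact: measurable_funD.
  move=> x Ox /=; rewrite lee_fin [leRHS]ger0_norm ?addr_ge0//.
  by apply: normr_between; apply: (chi_le chiP) => //; [exact: h0..|exact: hL].
have t0 : (0 < ((2 * tau)^-1)%:E)%E by rewrite lte_fin invr_gt0 mulr_gt0.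
have obj_oo : (diffusion_obj tau chi Om rh eh rho eta < +oo)%E.
  apply: le_lt_trans (mini _ _ rhP ehP) _.
  by rewrite /diffusion_obj !W2sq_diag adde0 mule0 add0e.
have [W1fin W2fin Efin] : [/\ W2sq rho rh \is a fin_num,
    W2sq eta eh \is a fin_num & energy chi Om rho eta \is a fin_num].
  have := energy_ge mOm Omoo chiP rho eta; rewrite lebOm -EFinM.
  move: obj_oo (W2sq_ge0 rho rh) (W2sq_ge0 eta eh); rewrite /diffusion_obj.
  case: (W2sq rho rh) => [w1| |]; case: (W2sq eta eh) => [w2| |];
    case: (energy chi Om rho eta) => [en| |] //=;
    by rewrite ?addye ?addey// ?gt0_muley//.
have [f1 [f2 [rf1 ef2]]] : exists f1 f2, has_density Om rho f1 /\ has_density Om eta f2.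
  have : (energy chi Om rho eta < +oo)%E by move: Efin; rewrite fin_numElt => /andP[].
  by move=> /ereal_inf_lt[_ [[f1 f2] [/= ? ?] _] _]; exists f1, f2.
have [mf1 [f10 rhoE]] := rf1; have [mf2 [f20 etaE]] := ef2.
pose S := f1 \+ f2.
have mS : measurable_fun Om S by exact: measurable_funD.
have S0 x : Om x -> 0 <= S x by move=> Ox; rewrite addr_ge0 ?f10 ?f20.
have SM : {ae lebesgue_measure, forall x, Om x -> S x <= M}.
  have : lebesgue_measure.-negligible (\bigcup_n (Om `&` [set x | M + n.+1%:R^-1 < S x])).
    apply: negligible_bigcup => n; apply/negligibleP; first exact: measurable_superlevel.
    have Mn : M < M + n.+1%:R^-1 by rewrite ltrDl.
    have [u1 [u2 [ru1 eu2 uL]]] := dens _ Mn.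
    apply: (minimizer_density_le mOm Omoo chiP tau0 _ rf1 ef2 ru1 eu2 uL rhT ehT) => //.
    exact: le_lt_trans Mn.
  apply: negligibleS => x /= nSM; apply: contrapT => nF; apply: nSM => Ox.
  rewrite leNgt; apply/negP => /ltr_add_invr[k Mk]; apply: nF.
  by exists k.
exists (S \min cst M); split; [|split].
- by apply: measurable_minr => //; exact: measurable_cst.
- move=> x Ox /=; rewrite ME lee_fin le_min ge_min lexx orbT; split => //.
  by rewrite (S0 _ Ox).
- move=> A mA; rewrite measure_addE rhoE// etaE//.
  have mI : measurable (A `&` Om) by exact: measurableI.
  have sub f : measurable_fun Om f -> measurable_fun (A `&` Om) (EFin \o f).
    by move=> mf; apply/measurable_EFinP; apply: measurable_funS mf => //; exact: subIsetr.
  rewrite -ge0_integralD//; [|by move=> x [_ Ox]; rewrite lee_fin f10|exact: sub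
    |by move=> x [_ Ox]; rewrite lee_fin f20|exact: sub].
  apply: ae_eq_integral => //.
  + by apply: emeasurable_funD; exact: sub.
  + by apply: sub; apply: measurable_minr => //; exact: measurable_cst.
  + apply: filterS SM => x SM [_ Ox] /=; rewrite -EFinD; congr EFin.
    by apply/esym/min_idPl; exact: SM.
Qed.
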